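(* Let $\alpha$ be a type, let $A$ and $X$ be sets of constructions (i.e. $A,X\subseteq\mathcal{P}(\mathrm{Node}_\alpha)$), and let $M\in\mathcal{P}(\mathrm{Node}_\alpha)$. If $M\in X$ and $X\subseteq \mathrm{List\_Fun}\,A\,X\cup\mathrm{LList}\,A$, then $M\in\mathrm{LList}\,A$.
   Context: Setting: classical higher-order logic. $\mathbb{N}$ denotes the natural numbers including $0$; $\sigma+\tau$ is the disjoint sum type with injections $\mathrm{Inl},\mathrm{Inr}$. Nodes and trees: for a type $\alpha$, $\mathrm{Node}_\alpha$ is the type of pairs $(g,y)$ with $g:\mathbb{N}\to\mathbb{N}$, $y:\alpha+\mathbb{N}$, such that $g\,n=0$ for some $n$. A construction (tree) is an arbitrary set of nodes, i.e. an element of $\mathcal{P}(\mathrm{Node}_\alpha)$. For $k\in\mathbb{N}$ and $g:\mathbb{N}\to\mathbb{N}$, $\mathrm{Push}\,k\,g:\mathbb{N}\to\mathbb{N}$ is given by $(\mathrm{Push}\,k\,g)(0)=k+1$ and $(\mathrm{Push}\,k\,g)(j+1)=g(j)$. Define $M\cdot N=\{(\mathrm{Push}\,0\,g,y)\mid (g,y)\in M\}\cup\{(\mathrm{Push}\,1\,g,y)\mid (g,y)\in N\}$, $\mathrm{Numb}\,k=\{(\lambda i.0,\ \mathrm{Inr}\,k)\}$, $\mathrm{In0}\,M=\mathrm{Numb}\,0\cdot M$, $\mathrm{In1}\,N=\mathrm{Numb}\,1\cdot N$. Operators on sets of constructions: $A\otimes B=\{x\cdot y\mid x\in A,\ y\in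 B\}$ and $A\oplus B=\{\mathrm{In0}\,x\mid x\in A\}\cup\{\mathrm{In1}\,y\mid y\in B\}$. Greatest fixedpoint: for an operator $F$ on subsets of a type, $\mathrm{gfp}\,F=\bigcup\{X\mid X\subseteq F\,X\}$. Lazy lists: $\mathrm{List\_Fun}\,A\,Z=\{\mathrm{Numb}\,0\}\oplus(A\otimes Z)$ and $\mathrm{LList}\,A=\mathrm{gfp}(\lambda Z.\ \mathrm{List\_Fun}\,A\,Z)$. *)

(* Defs.v *)
From mathcomp Require Import all_boot boolp classical_sets.

Set Implicit Arguments.
Unset Strict Implicit.
Unset Printing Implicit Defensive.

Local Open Scope classical_set_scope.

(* By proof irrelevance, nodes are equal as soon as their first two fields
   agree. *)
Record Node (alpha : Type) : Type := MkNode {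
  node_fun : nat -> nat;
  node_lab : alpha + nat;
  node_funP : exists n, node_fun n = 0 }.

Definition construction (alpha : Type) : Type := set (Node alpha).

Definition Push (k : nat) (g : nat -> nat) : nat -> nat :=
  fun i => if i is j.+1 then g j else k.+1.

Lemma Push_funP (k : nat) (g : nat -> nat) :
  (exists n, g n = 0) -> exists n, Push k g n = 0.
Proof. by case=> n gn0; exists n.+1. Qed.

Definition push_node (alpha : Type) (k : nat) (p : Node alpha) : Node alpha :=
  MkNode (node_lab p) (Push_funP k (node_funP p)).

(* The binary operation written M . N in the literature. *)
Definition Scons (alpha : Type) (M N : construction alpha) :
    construction alpha :=
  (push_node 0 @` M) `|` (push_node 1 @` N).

Lemma zero_funP : exists n, (fun _ : nat => 0) n = 0.
Proof. by exists 0. Qed.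

Definition Numb (alpha : Type) (k : nat) : construction alpha :=
  [set MkNode (inr k) zero_funP].
Arguments Numb {alpha} k.

Definition In0 (alpha : Type) (M : construction alpha) : construction alpha :=
  Scons (Numb 0) M.

Definition In1 (alpha : Type) (N : construction alpha) : construction alpha :=
  Scons (Numb 1) N.

(* The product and sum of sets of constructions, usually written as circled
   multiplication and addition signs. *)
Definition uprod (alpha : Type) (A B : set (construction alpha)) :
    set (construction alpha) :=
  [set Scons x y | x in A & y in B].

Definition usum (alpha : Type) (A B : set (construction alpha)) :
    set (construction alpha) :=
  [set In0 x | x in A] `|` [set In1 y | y in B].

(* F is not required to be monotone. *)
Definition gfp (T : Type) (F : set T -> set T) : set T :=
  \bigcup_(X in [set X | X `<=` F X]) X.

Definition List_Fun (alpha : Type) (A Z : set (construction alpha)) :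
    set (construction alpha) :=
  usum [set Numb 0] (uprod A Z).

Definition LList (alpha : Type) (A : set (construction alpha)) :
    set (construction alpha) :=
  gfp (fun Z => List_Fun A Z).

(* Main.v *)
Require Import Defs.
From mathcomp Require Import all_boot boolp classical_sets.

Local Open Scope classical_set_scope.

(** [List_Fun A] is monotone, so strong coinduction applies: elements of [X] may unfold into [X] or
    fall into the greatest fixedpoint, because the union of the two is still post-fixed. *)

Lemma gfp_postfixed (T : Type) (F : set T -> set T) :
  {homo F : X Y / X `<=` Y} -> gfp F `<=` F (gfp F).
Proof.
move=> F_mono x [X XFX Xx].
(* The post-fixed [X] is one of the sets united in [gfp F], so [F X] lies in [F (gfp F)]. *)
by apply: (F_mono X) => [y Xy|]; [exists X | exact: XFX].
Qed.

Lemma gfp_coinduct (T : Type) (F : set T -> set T) (X : set T) :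
  {homo F : X Y / X `<=` Y} -> X `<=` F X `|` gfp F -> X `<=` gfp F.
Proof.
(* Adding [gfp F] to [X] makes both alternatives of [XF] land in the image of one set. *)
move=> F_mono XF x Xx; exists (X `|` gfp F); last by left.
have F_gfp : gfp F `<=` F (X `|` gfp F).
  apply: subset_trans (F_mono _ _ (@subsetUr _ X (gfp F))).
  exact: gfp_postfixed.
rewrite /= subUset; split=> //.
apply: (subset_trans XF); rewrite subUset; split=> //.
exact/F_mono/subsetUl.
Qed.

(** The argument enters only as the set of tails in the right summand. *)
Lemma List_Fun_mono (alpha : Type) (A : set (construction alpha)) :
  {homo List_Fun A : Z W / Z `<=` W}.
Proof.
move=> Z W ZW; apply: setUS; apply: image_subset.
by move=> _ [x Ax [y Zy <-]]; exists x => //; exists y => //; exact: ZW.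
Qed.

Theorem mainTheorem2 (alpha : Type) (A X : set (construction alpha))
    (M : construction alpha) :
  X M -> X `<=` List_Fun A X `|` LList A -> LList A M.
Proof.
by move=> XM XF; apply: gfp_coinduct XF _ XM; exact: List_Fun_mono.
Qed.
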